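(* Let $M$ be an oriented closed connected smooth $3$-manifold and let $\mathcal{L}$ be a riemannian $1$-foliation on $M$. Then $(M,\mathcal{L})$ is nonhyperbolic with respect to any riemannian metric on $M$; that is, for every riemannian metric on $M$, the whole manifold $M$ is not a hyperbolic set for $\mathcal{L}$.
   Context: A ($1$-dimensional) $1$-foliation $\mathcal{L}$ on $M$ means a nowhere vanishing smooth vector field on $M$; its flow is denoted $\mathcal{L}:\mathbb{R}\times M\to M$, with $\mathcal{L}^t:=\mathcal{L}(t,\cdot)$. Leaves are the orbits of this flow. Hyperbolic set. Fix a riemannian metric on $M$ with norm $\|\cdot\|$. A compact $\mathcal{L}$-invariant set $\Lambda\subset M$ is a hyperbolic set for $\mathcal{L}$ if there exist $C>0$ and $0<\lambda<1$ such that for each $x\in\Lambda$ there is a decomposition $T_xM=E^{ss}_x\oplus E^{uu}_x\oplus E^c_x$ with $\partial_t\mathcal{L}(t,x)|_{t=0}\in E^c_x\setminus\{0\}$, $\dim E^c_x=1$, $D_x\mathcal{L}^t(E^i_x)=E^i_{\mathcal{L}^t(x)}$ for $i=ss,uu$ and all $t\in\mathbb{R}$, and $$\|D_x\mathcal{L}^t|_{E^{ss}_x}\|\le C\lambda^{t}\ (t\ge 0),\qquad \|D_x\mathcal{L}^t|_{E^{uu}_x}\|\le C\lambda^{-t}\ (t\le 0).$$ Riemannian $1$-foliation. Let $D_0$ be the open unit disk in $\mathbb{R}^2$. For each $x\in M$ let $\iota_x:(D_0,0)\to(M,x)$ be a smooth embedding whose image $D_x$ is transverse to $\mathcal{L}$,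 and let $\epsilon_x>0$ be such that $\tilde\iota_x:D_0\times(-\epsilon_x,\epsilon_x)\to M$, $\tilde\iota_x(y,t)=\mathcal{L}^t(\iota_x(y))$, is an open embedding, with image $U_x$. Let $p_x:U_x\to D_0$ be $\tilde\iota_x^{-1}$ followed by the projection to $D_0$. For $x,y\in M$ let $\gamma_{xy}:=p_x\circ\iota_y$, defined on the (possibly empty) open set $\iota_y^{-1}(U_x)\subset D_0$. Put $\Gamma:=\{\gamma_{xy}\}_{x,y\in M}$ (the holonomy pseudo-group). $\mathcal{L}$ is called riemannian if there exist such embeddings $\iota_x$ $(x\in M)$ and a riemannian metric on $D_0$ invariant under all the locally defined diffeomorphisms in $\Gamma$. *)

(* Defs.v *)
From HB Require Import structures.
From mathcomp Require Import all_boot all_order all_algebra.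
From mathcomp Require Import all_classical all_reals all_analysis.

Set Implicit Arguments.
Unset Strict Implicit.
Unset Printing Implicit Defensive.

Import Order.TTheory GRing.Theory Num.Theory numFieldNormedType.Exports.

Local Open Scope classical_set_scope.
Local Open Scope ring_scope.

(* C^k and C^oo maps on a subset U of a normed space; only meaningful for U
   open, since the differential is the one of f as a map on the whole space. *)
Fixpoint Ck_on {R : realType} {V W : normedModType R} (k : nat) (U : set V)
    (f : V -> W) : Prop :=
  if k is k'.+1 then
    (forall x, U x -> differentiable f x) /\
    (forall v : V, Ck_on k' U (fun x => 'd f x v))
  else forall x, U x -> {for x, continuous f}.

Definition smooth_on {R : realType} {V W : normedModType R} (U : set V)
    (f : V -> W) : Prop :=
  forall k, Ck_on k U f.

(* A chart of M is a homeomorphism from an open set of M onto an open set of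
   R^n; [chart_fun] and [chart_inv] are total, with irrelevant values outside
   of [chart_dom] and [chart_cod]. *)
Record chart (R : realType) (n : nat) (M : topologicalType) := Chart {
  chart_dom : set M ;
  chart_cod : set 'rV[R]_n ;
  chart_fun :> M -> 'rV[R]_n ;
  chart_inv : 'rV[R]_n -> M ;
  chart_dom_open : open chart_dom ;
  chart_cod_open : open chart_cod ;
  chart_funS : forall x, chart_dom x -> chart_cod (chart_fun x) ;
  chart_invS : forall y, chart_cod y -> chart_dom (chart_inv y) ;
  chart_funK : forall x, chart_dom x -> chart_inv (chart_fun x) = x ;
  chart_invK : forall y, chart_cod y -> chart_fun (chart_inv y) = y ;
  chart_fun_cont : forall x, chart_dom x -> {for x, continuous chart_fun} ;
  chart_inv_cont : forall y, chart_cod y -> {for y, continuous chart_inv} }.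

Section Transition.
Context {R : realType} {n : nat} {M : topologicalType}.
Implicit Types c d : chart R n M.

Definition transition_dom c d : set 'rV[R]_n :=
  [set y | chart_cod c y /\ chart_dom d (chart_inv c y)].

Definition transition c d : 'rV[R]_n -> 'rV[R]_n :=
  fun y => d (chart_inv c y).

Definition smoothly_compatible c d : Prop :=
  smooth_on (transition_dom c d) (transition c d) /\
  smooth_on (transition_dom d c) (transition d c).

End Transition.

(* The atlas need not be maximal. *)
Record smooth_manifold (R : realType) (n : nat) := SmoothManifold {
  mfd_car :> topologicalType ;
  mfd_hausdorff : hausdorff_space mfd_car ;
  mfd_second_countable : @second_countable mfd_car ;
  atlas : set (chart R n mfd_car) ;
  atlas_cover : forall x, exists2 c, atlas c & chart_dom c x ;
  atlas_compat : forall c d, atlas c -> atlas d -> smoothly_compatible c d }.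

(* An orientation is an oriented atlas of the given smooth structure. *)
Definition orientation {R : realType} {n : nat} (M : smooth_manifold R n)
    (O : set (chart R n M)) : Prop :=
  [/\ forall x, exists2 c, O c & chart_dom c x,
      forall c d, O c -> atlas d -> smoothly_compatible c d,
      forall c d, O c -> O d -> smoothly_compatible c d &
      forall c d y, O c -> O d -> transition_dom c d y ->
        0 < \det ('J (transition c d) y)].

Section Tangent.
Context {R : realType} {n : nat} {M : smooth_manifold R n}.
Implicit Types x : M.

(* A fixed, arbitrary choice of a chart of the atlas around each point. *)
Definition chart_at x : chart R n M := s2val (cid2 (atlas_cover x)).

(* T_x M is identified with R^n through [chart_at x]: v : tangent x stands for
   the class of the pair (chart_at x, v), whose representative in another
   chart c around x is [dchart c x v]. *)
Definition tangent x : Type := 'rV[R]_n.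
HB.instance Definition _ x := Vector.on (tangent x).

Definition dchart (c : chart R n M) x (v : tangent x) : 'rV[R]_n :=
  'd (c \o chart_inv (chart_at x)) (chart_at x x) v.

Definition dchart_inv (c : chart R n M) (y : 'rV[R]_n) (v : 'rV[R]_n) :
    tangent (chart_inv c y) :=
  'd (chart_at (chart_inv c y) \o chart_inv c) y v.

Definition mdiff (f : M -> M) x (v : tangent x) : tangent (f x) :=
  'd (chart_at (f x) \o f \o chart_inv (chart_at x)) (chart_at x x) v.

(* V is a normed space, identified with its own tangent spaces. *)
Definition mdiff_from {V : normedModType R} (f : V -> M) (y : V) (v : V) :
    tangent (f y) :=
  'd (chart_at (f y) \o f) y v.

Definition velocity (c : R -> M) (t : R) : tangent (c t) :=
  'D_1 (fun s : R => chart_at (c t) (c s)) t.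

Definition smooth_vector_field (X : forall x, tangent x) : Prop :=
  forall c, atlas c ->
    smooth_on (chart_cod c)
      (fun y => dchart c (X (chart_inv c y))).

(* Smoothness, on an open set U of V, of a map into M. *)
Definition smooth_into {V : normedModType R} (U : set V) (f : V -> M) : Prop :=
  (forall y, U y -> {for y, continuous f}) /\
  (forall c, atlas c ->
    smooth_on (U `&` f @^-1` chart_dom c) (fun y => c (f y))).

Definition smooth_embedding {V : normedModType R} (U : set V) (f : V -> M) :
    Prop :=
  [/\ smooth_into U f,
      forall y, U y -> injective (mdiff_from f y),
      set_inj U f &
      forall A, open A -> A `<=` U ->
        exists2 B : set M, open B & f @` A = B `&` f @` U].

Definition open_embedding {V : normedModType R} (U : set V) (f : V -> M) :
    Prop :=
  smooth_embedding U f /\ open (f @` U).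

Definition smooth_flow (L : R -> M -> M) : Prop :=
  continuous (fun p : R * M => L p.1 p.2) /\
  (forall c d, atlas c -> atlas d ->
    smooth_on
      [set p : R * 'rV[R]_n |
        chart_cod c p.2 /\ chart_dom d (L p.1 (chart_inv c p.2))]
      (fun p : R * 'rV[R]_n => d (L p.1 (chart_inv c p.2)))).

End Tangent.

Definition inner_product {R : realType} {V : lmodType R} (b : V -> V -> R) :
    Prop :=
  [/\ forall a u v w, b (a *: u + v) w = a * b u w + b v w,
      forall u v, b u v = b v u &
      forall u, u != 0 -> 0 < b u u].

Definition riemannian_metric_on {R : realType} {n : nat} (U : set 'rV[R]_n)
    (h : 'rV[R]_n -> 'rV[R]_n -> 'rV[R]_n -> R) : Prop :=
  (forall y, U y -> inner_product (h y)) /\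
  (forall u v, smooth_on U (fun y => h y u v)).

Record riemannian_metric {R : realType} {n : nat} (M : smooth_manifold R n) :=
  RiemannianMetric {
  metric :> forall x : M, tangent x -> tangent x -> R ;
  metric_inner : forall x, inner_product (@metric x) ;
  metric_smooth : forall c, atlas c -> forall u v,
    smooth_on (chart_cod c)
      (fun y => metric (dchart_inv c y u) (dchart_inv c y v)) }.

(* A nowhere vanishing smooth vector field together with its flow. *)
Record foliation {R : realType} {n : nat} (M : smooth_manifold R n) :=
  Foliation {
  fol_vf : forall x : M, tangent x ;
  fol_vf_smooth : smooth_vector_field fol_vf ;
  fol_vf_neq0 : forall x, fol_vf x != 0 ;
  flow : R -> M -> M ;
  flow_smooth : smooth_flow flow ;
  flow0 : forall x, flow 0 x = x ;
  flowD : forall s t x, flow (s + t) x = flow s (flow t x) ;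
  flow_velocity : forall x t, velocity (flow^~ x) t = fol_vf (flow t x) }.

Section Hyperbolic.
Context {R : realType} {n : nat} {M : smooth_manifold R n}.

Definition metric_norm (g : riemannian_metric M) (x : M) (v : tangent x) : R :=
  Num.sqrt (g x v v).

Definition opnorm_on (g : riemannian_metric M) (x y : M)
    (E : {vspace tangent x}) (A : tangent x -> tangent y) : \bar R :=
  ereal_sup [set (metric_norm g (A v))%:E |
              v in [set v | v \in E /\ metric_norm g v <= 1]].

Definition hyperbolic_set (F : foliation M) (g : riemannian_metric M)
    (Lam : set M) : Prop :=
  [/\ compact Lam,
      forall t x, Lam x -> Lam (flow F t x) &
      exists (C lam : R) (Ess Euu Ec : forall x : M, {vspace tangent x}),
        [/\ 0 < C, 0 < lam < 1 &
            forall x, Lam x ->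
            [/\ (Ess x + Euu x + Ec x)%VS = fullv /\
                  directv (Ess x + Euu x + Ec x),
                [/\ fol_vf F x \in Ec x, fol_vf F x != 0 & \dim (Ec x) = 1%N],
                forall t,
                  (linfun (mdiff (flow F t) (x := x)) @: Ess x)%VS
                    = Ess (flow F t x) /\
                  (linfun (mdiff (flow F t) (x := x)) @: Euu x)%VS
                    = Euu (flow F t x),
                forall t, 0 <= t ->
                  (opnorm_on g (Ess x) (mdiff (flow F t) (x := x))
                    <= (C * lam `^ t)%:E)%E &
                forall t, t <= 0 ->
                  (opnorm_on g (Euu x) (mdiff (flow F t) (x := x))
                    <= (C * lam `^ (- t))%:E)%E]]].

End Hyperbolic.

(* The Euclidean open unit disk: the norm of 'rV_2 is the sup norm. *)
Definition disk {R : realType} : set 'rV[R]_2 :=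
  [set y | \sum_i y ord0 i ^+ 2 < 1].

Section Riemannian.
Context {R : realType} {M : smooth_manifold R 3}.
Variables (F : foliation M) (iota : M -> 'rV[R]_2 -> M) (eps : M -> R).

Definition flow_box (x : M) : set ('rV[R]_2 * R) :=
  [set p | disk p.1 /\ - eps x < p.2 < eps x].

Definition iota_tilde (x : M) (p : 'rV[R]_2 * R) : M :=
  flow F p.2 (iota x p.1).

Definition transversal_disk (x : M) : Prop :=
  [/\ smooth_embedding disk (iota x), iota x 0 = x &
      forall y, disk y ->
        (limg (linfun (mdiff_from (iota x) y)) + <[fol_vf F (iota x y)]>)%VS
          = fullv].

Definition box_image (x : M) : set M := iota_tilde x @` flow_box x.

Definition box_proj (x : M) (z : M) : 'rV[R]_2 :=
  ('pinv_(fun=> 0) (flow_box x) (iota_tilde x) z).1.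

Definition holonomy_dom (x y : M) : set 'rV[R]_2 :=
  disk `&` iota y @^-1` box_image x.

Definition holonomy (x y : M) : 'rV[R]_2 -> 'rV[R]_2 :=
  box_proj x \o iota y.

Definition holonomy_invariant (h : 'rV[R]_2 -> 'rV[R]_2 -> 'rV[R]_2 -> R) :
    Prop :=
  forall x y a, holonomy_dom x y a -> forall u v,
    h (holonomy x y a) ('d (holonomy x y) a u) ('d (holonomy x y) a v)
      = h a u v.

End Riemannian.

Definition riemannian_foliation {R : realType} {M : smooth_manifold R 3}
    (F : foliation M) : Prop :=
  exists (iota : M -> 'rV[R]_2 -> M) (eps : M -> R),
    (forall x, [/\ transversal_disk F iota x, 0 < eps x &
       open_embedding (flow_box eps x) (iota_tilde F iota x)]) /\
    exists h, riemannian_metric_on disk h /\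
      holonomy_invariant F iota eps h.

(* Main.v *)
From HB Require Import structures.
Require Import Defs.
From mathcomp Require Import all_boot all_order all_algebra.
From mathcomp Require Import all_classical all_reals all_analysis.
From mathcomp Require Import ring lra.

Import Order.TTheory GRing.Theory Num.Theory numFieldNormedType.Exports.

Local Open Scope classical_set_scope.

Set Implicit Arguments.
Unset Strict Implicit.
Unset Printing Implicit Defensive.

(** A riemannian flow carries a quadratic form [transverse_sq] on the tangent
    spaces of M: write a tangent vector v at z in the flow box centred at z as
    the image of (xi, tau), xi along the transverse disk and tau along the flow,
    and take the length h_0(xi, xi) given by the metric h of the disk.
    Invariance of h under the holonomy maps p_x o iota_z says exactly that any
    other box through z computes the same number ([holonomy_push],
    [transverse_sq_push]); since the flow acts on a box by translating the time
    coordinate, the form is constant along the flow for short times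
    ([transverse_sq_flow_small]), hence, being then locally constant in the
    time, for all times ([transverse_sq_flow]).

    The form is continuous, so near any point w it is bounded by a multiple of
    any riemannian metric g ([transverse_sq_le]).  Let v be a vector at z whose
    g-length tends to 0 along times t_k.  By compactness the points at times t_k
    accumulate at some w, near which the invariant number [transverse_sq z v] is
    bounded by a multiple of squared g-lengths tending to 0, so it vanishes.
    As h is positive definite, xi = 0: v is tangent to the flow.  Applied to
    times going to +oo and to -oo, this puts the stable and the unstable
    directions of a hyperbolic splitting inside the line of the flow
    ([contracted_sub_line]), so that the three subspaces together span only a
    line in a space of dimension 3.

    The flow boxes are given by their parametrizations, whereas the holonomy
    involves the inverse maps; the differential of these comes from
    [is_diff_right_inverse], the easy half of the inverse function theorem: a
    continuous right inverse is differentiable wherever the differential is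
    invertible. *)

(** * Differentials of maps between normed spaces *)

Section Calculus.
Local Open Scope ring_scope.
Context {R : realType}.

Lemma is_diff_eps (V W : normedModType R) (f : V -> W) (x : V)
    (A : {linear V -> W}) : continuous A ->
  (forall e : R, 0 < e ->
     \forall h \near 0, `|f (h + x) - f x - A h| <= e * `|h|) ->
  is_diff x f A.
Proof.
move=> cA fA.
have fxA : f \o shift x = cst (f x) + A +o_ 0 id.
  apply/eqaddoP => e e0; near=> h.
  rewrite !fctE /= /cst opprD addrA.
  by near: h; exact: fA.
have dfA : 'd f x = A :> (V -> W) by exact: diff_unique.
by split=> //; apply/diff_locallyP; rewrite dfA.
Unshelve. all: by end_near. Qed.

Lemma diff_eps (V W : normedModType R) (f : V -> W) (x : V) :
  differentiable f x ->
  forall e : R, 0 < e ->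
    \forall h \near 0, `|f (h + x) - f x - 'd f x h| <= e * `|h|.
Proof.
move=> /diff_locallyP[_ /eqaddoP fo] e e0.
by apply: filterS (fo e e0) => h; rewrite !fctE /= /cst opprD addrA.
Qed.

Lemma near_eq_is_diff (V W : normedModType R) (f g : V -> W) (x : V) :
  (\forall y \near x, f y = g y) -> differentiable f x ->
  is_diff x g ('d f x).
Proof.
move=> fg df; apply: is_diff_eps; first exact: diff_continuous.
move=> e e0.
have fg0 : \forall h \near (0 : V), f (h + x) = g (h + x).
  by move: fg; rewrite (near_shift 0)/= subr0.
near=> h.
rewrite -(nbhs_singleton fg).
have <- : f (h + x) = g (h + x) by near: h.
by near: h; exact: diff_eps.
Unshelve. all: by end_near. Qed.

Lemma near_eq_diff (V W : normedModType R) (f g : V -> W) (x : V) v :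
  (\forall y \near x, f y = g y) -> differentiable f x ->
  'd g x v = 'd f x v.
Proof.
move=> fg /(near_eq_is_diff fg) dg.
by rewrite -[LHS]/(('d g x : V -> W) v) (diff_val (is_diff_def := dg)).
Qed.

Lemma diff_compE (U V W : normedModType R) (f : U -> V) (g : V -> W) x u :
  differentiable f x -> differentiable g (f x) ->
  'd (g \o f) x u = 'd g (f x) ('d f x u).
Proof. by move=> df dg; exact: (congr1 (fun k => k u) (diff_comp df dg)). Qed.

Lemma near_eq_differentiable (V W : normedModType R) (f g : V -> W) (x : V) :
  (\forall y \near x, f y = g y) -> differentiable f x -> differentiable g x.
Proof. by move=> fg /(near_eq_is_diff fg) ?; exact: ex_diff. Qed.

(** With h = g (y + k) - g y and r the remainder of f at g y, one has
    k = 'd f h + r, hence h - B k = - B r.  As r is small with respect to h,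
    this bounds h by a multiple of k, and then r is small with respect to k. *)
Lemma is_diff_right_inverse (V W : normedModType R) (f : V -> W) (g : W -> V)
    (y : W) (B : {linear W -> V}) : continuous B ->
  differentiable f (g y) -> (forall v, B ('d f (g y) v) = v) ->
  {for y, continuous g} -> (\forall z \near y, f (g z) = z) ->
  is_diff y g B.
Proof.
move=> cB df BK cg fg; apply: is_diff_eps => // e e0.
have [c c0 Bc] := linear_lipschitz cB.
(* c bounds B: e1 <= 1 / (2 c) absorbs the error term into |h| <= 2 c |k|, and
   e1 <= e / (2 c ^ 2) then makes the error c e1 |h| at most e |k|. *)
pose e1 : R := Num.min (2^-1 / c) (e / (2 * c ^+ 2)).
have e1_gt0 : 0 < e1 by rewrite lt_min !divr_gt0 ?mulr_gt0 ?exprn_gt0.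
have ce1 : c * e1 <= 2^-1.
  by rewrite mulrC -ler_pdivlMr// ge_min lexx.
have c2e1 : 2 * c ^+ 2 * e1 <= e.
  by rewrite mulrC -ler_pdivlMr ?mulr_gt0 ?exprn_gt0// ge_min lexx orbT.
have gd : (fun k : W => g (k + y) - g y) k @[k --> 0] --> (0 : V).
  rewrite -(subrr (g y)); apply: cvgB; last exact: cvg_cst.
  by rewrite (cvg_comp_shift y 0 g) add0r; exact: cg.
have fgs : \forall k \near (0 : W), f (g (k + y)) = k + y.
  by move: fg; rewrite (near_shift 0)/= subr0.
have {}df := gd _ (diff_eps df e1_gt0).
near=> k.
have : `|f (g (k + y) - g y + g y) - f (g y) - 'd f (g y) (g (k + y) - g y)|
    <= e1 * `|g (k + y) - g y| by near: k.
have fgk : f (g (k + y)) = k + y by near: k.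
rewrite subrK fgk (nbhs_singleton fg) addrK.
set h := g (k + y) - g y => hk.
have -> : h - B k = - B (k - 'd f (g y) h) by rewrite linearB BK opprB.
rewrite normrN.
have Br : `|B (k - 'd f (g y) h)| <= c * e1 * `|h|.
  by apply: (le_trans (Bc _)); rewrite -mulrA ler_pM2l.
have hb : `|h| <= 2 * c * `|k|.
  have -> : 2 * c * `|k| = 2 * (c * `|k|) by ring.
  have : `|h| <= c * `|k| + 2^-1 * `|h|.
    have {1}-> : h = B k - B (k - 'd f (g y) h) by rewrite linearB BK subKr.
    rewrite (le_trans (ler_normB _ _))// lerD// ?Bc//.
    by apply: le_trans Br _; rewrite ler_wpM2r.
  lra.
apply: (le_trans Br); apply: (@le_trans _ _ (c * e1 * (2 * c * `|k|))).
  by rewrite ler_wpM2l// ?mulr_ge0 ?ltW.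
have -> : c * e1 * (2 * c * `|k|) = 2 * c ^+ 2 * e1 * `|k| by ring.
by rewrite ler_wpM2r.
Unshelve. all: by end_near. Qed.

Lemma linear_rV_continuous (n : nat) (V : normedModType R)
    (B : {linear 'rV[R]_n -> V}) : continuous B.
Proof.
have -> : (B : 'rV[R]_n -> V) =
    \sum_(i < n) (fun w : 'rV[R]_n => w 0 i *: B (delta_mx 0 i)).
  apply/funext => w; rewrite fct_sumE {1}(row_sum_delta w) linear_sum.
  by apply: eq_bigr => i _; rewrite linearZ.
move=> w; apply: differentiable_continuous; apply: differentiable_sum => i.
apply: (@differentiableZl _ _ _ (fun w : 'rV[R]_n => w 0 i)).
exact: differentiable_coord.
Qed.

(** By equality of dimensions, injectivity is enough; the inverse is continuous
    because its domain consists of row vectors. *)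
Lemma linear_inj_inverse (n : nat)
    (A : {linear ('rV[R]_n * R)%type -> 'rV[R]_(n + 1)}) : injective A ->
  exists B : {linear 'rV[R]_(n + 1) -> ('rV[R]_n * R)%type},
    [/\ continuous B, cancel A B & cancel B A].
Proof.
move=> injA.
pose j (w : 'rV[R]_(n + 1)) : 'rV[R]_n * R := (lsubmx w, rsubmx w 0 0).
have jlin : linear j.
  by move=> a u w; apply/pair_equal_spec; split; rewrite /= ?linearP// !mxE.
have jK (p : 'rV[R]_n * R) : j (row_mx p.1 p.2%:M) = p.
  by case: p => a s; rewrite /j row_mxKl row_mxKr !mxE eqxx mulr1n.
have Kj w : row_mx (j w).1 (j w).2%:M = w.
  by rewrite /j/= -mx11_scalar hsubmxK.
pose N := lin1_mx (A \o j).
have Nlin : linear (A \o j) by move=> a u w; rewrite /= jlin linearP.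
have NE w : w *m N = A (j w).
  pose L : {linear 'rV[R]_(n + 1) -> 'rV[R]_(n + 1)} :=
    HB.pack (A \o j) (GRing.isLinear.Build _ _ _ _ _ Nlin).
  by rewrite -[A (j w)]/(L w) -(mul_rV_lin1 L).
have Nunit : N \in unitmx.
  rewrite -row_free_unit; apply: inj_row_free => w.
  move=> wN0; have /injA jw0 : A (j w) = A 0 by rewrite -NE wN0 linear0.
  by rewrite -(Kj w) jw0 /= raddf0 row_mx0.
have Blin : linear (fun w => j (w *m invmx N)).
  by move=> a u w; rewrite mulmxDl -scalemxAl jlin.
pose B : {linear 'rV[R]_(n + 1) -> ('rV[R]_n * R)%type} :=
  HB.pack (fun w => j (w *m invmx N)) (GRing.isLinear.Build _ _ _ _ _ Blin).
exists B; split; first exact: linear_rV_continuous.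
- by move=> v; rewrite /B/= -[v in A v]jK -NE mulmxK// jK.
- by move=> w; rewrite /B/= -NE mulmxKV.
Qed.

Lemma diff_comp_shift (V W : normedModType R) (f : V -> W) (a v : V) :
  differentiable f a -> 'd (f \o shift a) 0 v = 'd f a v.
Proof.
move=> df.
have [ds dsE] : is_diff 0 (shift a) (id : V -> V).
  apply: (@is_diff_eps _ _ _ _ idfun) => [x|e e0]; first exact: cvg_id.
  apply: nearW => h /=.
  by rewrite addr0 add0r addrK subrr normr0 mulr_ge0// ltW.
have df0 : differentiable f (shift a 0) by rewrite /= add0r.
apply: (etrans (diff_compE v ds df0)).
rewrite (congr1 (fun k => k v) dsE : 'd (shift a) 0 v = v).
by rewrite /= add0r.
Qed.

Lemma is_diff_fst (V W : normedModType R) (p : V * W) :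
  is_diff p (fst : V * W -> V) (fst : V * W -> V).
Proof.
pose fst_lin : {linear (V * W)%type -> V} := fst.
have cfst : continuous fst_lin by move=> q; exact: cvg_fst.
by split; [exact: (linear_differentiable p cfst)|exact: (diff_lin p cfst)].
Qed.

End Calculus.

(** * Families of symmetric bilinear forms on row vectors *)

Section BilinearForms.
Local Open Scope ring_scope.
Context {R : realType}.

(** The two axioms of [inner_product] that survive for the transverse form, which
    is only semidefinite on the tangent spaces of the manifold. *)
Definition sym_bilinear (V : lmodType R) (b : V -> V -> R) : Prop :=
  (forall a u v w, b (a *: u + v) w = a * b u w + b v w) /\
  (forall u v, b u v = b v u).

Lemma sym_bilinear0 (V : lmodType R) (b : V -> V -> R) v :
  sym_bilinear b -> b 0 v = 0.
Proof.
by move=> [bl _]; have := bl 1 0 0 v; rewrite scale1r addr0 mul1r => /eqP; lra.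
Qed.

Lemma sym_bilinearZ (V : lmodType R) (b : V -> V -> R) k v :
  sym_bilinear b -> b (k *: v) (k *: v) = k ^+ 2 * b v v.
Proof.
move=> bb; have [bl bs] := bb.
have bZ a u w : b (a *: u) w = a * b u w.
  by rewrite -[a *: u]addr0 bl sym_bilinear0// addr0.
by rewrite bZ bs bZ; ring.
Qed.

Lemma sym_bilinear_sum n (b : 'rV[R]_n -> 'rV[R]_n -> R) u v :
  sym_bilinear b -> b u v =
  \sum_(i < n) \sum_(j < n) u 0 i * v 0 j * b (delta_mx 0 i) (delta_mx 0 j).
Proof.
move=> bb; have [bl bs] := bb.
have bsum (s : seq 'I_n) (c : 'I_n -> R) (e : 'I_n -> 'rV[R]_n) w :
    b (\sum_(i <- s) c i *: e i) w = \sum_(i <- s) c i * b (e i) w.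
  elim: s => [|i s IH]; first by rewrite !big_nil sym_bilinear0.
  by rewrite !big_cons bl IH.
rewrite {1}(row_sum_delta u) bsum; apply: eq_bigr => i _.
rewrite bs {1}(row_sum_delta v) bsum mulr_sumr; apply: eq_bigr => j _.
by rewrite bs mulrA.
Qed.

Lemma row_coord_le n (u : 'rV[R]_n) i : `|u 0 i| <= `|u|.
Proof.
rewrite [leRHS]/Num.norm /= mx_normrE.
by apply/bigmax_geP; right => /=; exists (0, i).
Qed.

Definition coef_sum n (b : 'rV[R]_n -> 'rV[R]_n -> R) : R :=
  \sum_(i < n) \sum_(j < n) `|b (delta_mx 0 i) (delta_mx 0 j)|.

Lemma coef_sum_ge0 n (b : 'rV[R]_n -> 'rV[R]_n -> R) : 0 <= coef_sum b.
Proof. by apply: sumr_ge0 => i _; apply: sumr_ge0. Qed.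

Lemma sym_bilinear_le n (b : 'rV[R]_n -> 'rV[R]_n -> R) u :
  sym_bilinear b -> `|b u u| <= coef_sum b * `|u| ^+ 2.
Proof.
move=> bb; rewrite sym_bilinear_sum// /coef_sum mulr_suml.
apply: (le_trans (ler_norm_sum _ _ _)); apply: ler_sum => i _.
rewrite mulr_suml; apply: (le_trans (ler_norm_sum _ _ _)).
apply: ler_sum => j _; rewrite !normrM mulrC ler_wpM2l// expr2.
by rewrite ler_pM// row_coord_le.
Qed.

Lemma cvg_sum {T : Type} (F : set_system T) {FF : Filter F} (I : Type)
    (s : seq I) (f : I -> T -> R) (l : I -> R) :
  (forall i, f i x @[x --> F] --> l i) ->
  (\sum_(i <- s) f i x) @[x --> F] --> \sum_(i <- s) l i.
Proof.
move=> fl; elim: s => [|i s IH].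
  by rewrite big_nil; under eq_cvg do rewrite big_nil; exact: cvg_cst.
by rewrite big_cons; under eq_cvg do rewrite big_cons; exact: cvgD.
Qed.

Lemma coef_sum_cvg {T : Type} (F : set_system T) {FF : Filter F} n
    (b : T -> 'rV[R]_n -> 'rV[R]_n -> R) (b0 : 'rV[R]_n -> 'rV[R]_n -> R) :
  (forall u v, b q u v @[q --> F] --> b0 u v) ->
  coef_sum (b q) @[q --> F] --> coef_sum b0.
Proof.
move=> bb0; apply: cvg_sum => i; apply: cvg_sum => j.
exact: cvg_norm.
Qed.

Lemma sym_bilinear_continuous n (b : 'rV[R]_n -> 'rV[R]_n -> R) :
  sym_bilinear b -> continuous (fun u => b u u).
Proof.
move=> bb u.
have -> : (fun u => b u u) = (fun u => \sum_(i < n) \sum_(j < n)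
    u 0 i * u 0 j * b (delta_mx 0 i) (delta_mx 0 j)).
  by apply/funext => v; exact: sym_bilinear_sum.
apply: (cvg_sum (F := nbhs u)) => i; apply: (cvg_sum (F := nbhs u)) => j.
apply: cvgM; last exact: cvg_cst.
by apply: cvgM; exact: coord_continuous.
Qed.

(** The constant is the minimum of the form on the compact unit sphere. *)
Lemma pos_def_ge n (b : 'rV[R]_n -> 'rV[R]_n -> R) :
  sym_bilinear b -> (forall u, u != 0 -> 0 < b u u) ->
  exists2 m, 0 < m & forall u, m * `|u| ^+ 2 <= b u u.
Proof.
move=> bb bpos.
pose S := [set u : 'rV[R]_n | `|u| = 1].
have [S0|/set0P/negP/negPn/eqP S0] := pselect (S !=set0); last first.
  exists 1 => // u; have [->|u0] := eqVneq u 0.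
    by rewrite normr0 sym_bilinear0// expr0n mulr0.
  suff : S (`|u|^-1 *: u) by rewrite S0.
  by rewrite /S/= normrZ normfV normr_id mulVf// normr_eq0.
have cS : compact S.
  apply: bounded_closed_compact.
    by exists 1; split => // x x1 u /= ->; exact: ltW.
  rewrite (_ : S = (fun u => `|u|) @^-1` [set 1])//.
  apply: preimage_closed => [u _|]; first exact: norm_continuous.
  exact: closed_eq.
have [c Sc cmin] : exists2 c, c \in S & forall t, t \in S -> b c c <= b t t.
  apply: (EVT_min_rV S0 cS); apply: continuous_subspaceT.
  exact: sym_bilinear_continuous.
have c0 : c != 0.
  by apply: contra_eq_neq (set_mem Sc) => ->; rewrite normr0 eq_sym oner_eq0.
exists (b c c); first exact: bpos.
move=> u; have [->|u0] := eqVneq u 0.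
  by rewrite normr0 sym_bilinear0// expr0n mulr0.
have nu : `|u| != 0 by rewrite normr_eq0.
rewrite -[X in _ <= b X X](scalerKV nu) sym_bilinearZ// mulrC ler_wpM2l ?sqr_ge0//.
by apply: cmin; apply: mem_set; rewrite /S/= normrZ normfV normr_id mulVf.
Qed.

(** If b0 >= m |u|^2 then b q >= (m / 2) |u|^2 as soon as the coefficients of
    b q - b0 have sum at most m / 2, while the coefficients of a q stay bounded.
    Working with coefficients makes pointwise convergence sufficient. *)
Lemma near_form_le {T : Type} (F : set_system T) {FF : Filter F} n
    (a b : T -> 'rV[R]_n -> 'rV[R]_n -> R) (a0 b0 : 'rV[R]_n -> 'rV[R]_n -> R) :
  (\forall q \near F, sym_bilinear (a q)) ->
  (\forall q \near F, sym_bilinear (b q)) ->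
  sym_bilinear b0 -> (forall u, u != 0 -> 0 < b0 u u) ->
  (forall u v, a q u v @[q --> F] --> a0 u v) ->
  (forall u v, b q u v @[q --> F] --> b0 u v) ->
  exists2 K, 0 < K & \forall q \near F, forall u, a q u u <= K * b q u u.
Proof.
move=> aF bF bb0 b0pos aa0 bb0F.
have [m m0 mb] := pos_def_ge bb0 b0pos.
pose N := coef_sum a0 + 1.
have N0 : 0 < N by rewrite ltr_wpDl// coef_sum_ge0.
pose d q u v := b q u v - b0 u v.
have dF : coef_sum (d q) @[q --> F] --> (0 : R).
  have -> : (0 : R) = coef_sum (fun _ _ : 'rV[R]_n => 0 : R).
    by rewrite /coef_sum big1// => i _; rewrite big1// => j _; rewrite normr0.
  apply: coef_sum_cvg => u v; rewrite -(subrr (b0 u v)).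
  by apply: cvgB; [exact: bb0F|exact: cvg_cst].
have dm : \forall q \near F, coef_sum (d q) < m / 2.
  by apply: (cvgr_lt _ dF); rewrite divr_gt0.
have aN : \forall q \near F, coef_sum (a q) < N.
  by apply: (cvgr_lt _ (coef_sum_cvg aa0)); rewrite ltrDl.
exists (2 * N / m); first by rewrite divr_gt0// mulr_gt0.
near=> q => u.
have aq : sym_bilinear (a q) by near: q.
have bq : sym_bilinear (b q) by near: q.
have dq : sym_bilinear (d q).
  split=> [k v w x|v w]; rewrite /d.
    by rewrite bq.1 bb0.1; ring.
  by rewrite bq.2 bb0.2.
have dmq : coef_sum (d q) <= m / 2 by apply: ltW; near: q.
have aNq : coef_sum (a q) <= N by apply: ltW; near: q.
have au : a q u u <= N * `|u| ^+ 2.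
  apply: (le_trans (ler_norm _)); apply: (le_trans (sym_bilinear_le _ aq)).
  by rewrite ler_wpM2r ?sqr_ge0.
have du : `|d q u u| <= m / 2 * `|u| ^+ 2.
  by apply: (le_trans (sym_bilinear_le _ dq)); rewrite ler_wpM2r ?sqr_ge0.
have bu : m / 2 * `|u| ^+ 2 <= b q u u.
  move: du; rewrite ler_norml /d => /andP[du _]; have := mb u; lra.
apply: (le_trans au).
have -> : N * `|u| ^+ 2 = 2 * N / m * (m / 2 * `|u| ^+ 2).
  by field; rewrite gt_eqF.
by rewrite ler_wpM2l// ltW// divr_gt0// mulr_gt0.
Unshelve. all: by end_near. Qed.

End BilinearForms.

(** * Differentials of maps into a manifold *)

Section ChartCalculus.
Local Open Scope ring_scope.
Context {R : realType} {n : nat} {M : smooth_manifold R n}.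

Lemma smooth_on_differentiable (V W : normedModType R) (U : set V)
    (f : V -> W) x : smooth_on U f -> U x -> differentiable f x.
Proof. by move=> /(_ 1%N)[fU _]; exact: fU. Qed.

Lemma smooth_on_continuous (V W : normedModType R) (U : set V)
    (f : V -> W) x : smooth_on U f -> U x -> {for x, continuous f}.
Proof. by move=> /(_ 0%N); exact. Qed.

Lemma smooth_on_diff_continuous (V W : normedModType R) (U : set V)
    (f : V -> W) x v : smooth_on U f -> U x ->
  {for x, continuous (fun y => 'd f y v)}.
Proof. by move=> /(_ 1%N)[_ /(_ v)]; exact. Qed.

Lemma chart_at_atlas (x : M) : atlas (chart_at x).
Proof. exact: s2valP (cid2 (atlas_cover x)). Qed.

Lemma chart_at_dom (x : M) : chart_dom (chart_at x) x.
Proof. exact: s2valP' (cid2 (atlas_cover x)). Qed.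

(** The form of smoothness that the chain rule consumes and produces: it is
    stated at a point and keeps only the first derivative. *)
Definition smooth_at {V : normedModType R} (f : V -> M) (y : V) : Prop :=
  {for y, continuous f} /\
  forall c, atlas c -> chart_dom c (f y) -> differentiable (c \o f) y.

Definition smooth_map (phi : M -> M) : Prop :=
  continuous phi /\
  forall c d x, atlas c -> atlas d -> chart_dom c x -> chart_dom d (phi x) ->
    differentiable (d \o phi \o chart_inv c) (c x).

Lemma smooth_into_at {V : normedModType R} (U : set V) (f : V -> M) y :
  smooth_into U f -> U y -> smooth_at f y.
Proof.
move=> [fc fd] Uy; split=> [|c ac cfy]; first exact: fc.
by apply: smooth_on_differentiable (fd c ac) _.
Qed.

Lemma near_chart_dom {V : topologicalType} (f : V -> M) (y : V)
    (c : chart R n M) : {for y, continuous f} -> chart_dom c (f y) ->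
  \forall y' \near y, chart_dom c (f y').
Proof.
by move=> fc cfy; apply: fc; exact: open_nbhs_nbhs (conj (chart_dom_open c) cfy).
Qed.

Lemma near_comp_transition {V : topologicalType} (f : V -> M) (phi : M -> M)
    (y : V) (c d : chart R n M) : {for y, continuous f} -> chart_dom c (f y) ->
  \forall y' \near y,
    ((d \o phi \o chart_inv c) \o (c \o f)) y' = (d \o (phi \o f)) y'.
Proof.
move=> fc cfy; apply: filterS (near_chart_dom fc cfy) => y' cfy' /=.
by rewrite chart_funK.
Qed.

(** The chain rule through the intermediate chart c: it holds because phi o f
    factors through c near y. *)
Lemma diff_smooth_map {V : normedModType R} (f : V -> M) (phi : M -> M) (y : V)
    (c d : chart R n M) (v : V) :
  smooth_at f y -> smooth_map phi -> atlas c -> atlas d ->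
  chart_dom c (f y) -> chart_dom d (phi (f y)) ->
  'd (d \o (phi \o f)) y v =
  'd (d \o phi \o chart_inv c) (c (f y)) ('d (c \o f) y v).
Proof.
move=> [fc fd] [_ phid] ac ad cfy dfy.
have dcf := fd c ac cfy; have dphi := phid c d (f y) ac ad cfy dfy.
have dcomp := differentiable_comp dcf dphi.
have near_comp := near_comp_transition phi d fc cfy.
apply: (etrans (near_eq_diff (f := (d \o phi \o chart_inv c) \o (c \o f))
  v near_comp dcomp)).
exact: diff_compE.
Qed.

Lemma smooth_at_comp {V : normedModType R} (f : V -> M) (phi : M -> M) (y : V) :
  smooth_at f y -> smooth_map phi -> smooth_at (phi \o f) y.
Proof.
move=> fs phis; have [fc fd] := fs; have [phic phid] := phis.
split=> [|d ad dfy]; first by apply: continuous_comp => //; exact: phic.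
pose c := chart_at (f y).
have cfy := chart_at_dom (f y); have ac := chart_at_atlas (f y).
have near_comp := near_comp_transition phi d fc cfy.
apply: (@near_eq_differentiable _ _ _ _ (d \o (phi \o f)) _ near_comp).
by apply: differentiable_comp; [exact: fd|exact: phid].
Qed.

Lemma mdiff_mdiff_from {V : normedModType R} (f : V -> M) (phi : M -> M)
    (y : V) (v : V) : smooth_at f y -> smooth_map phi ->
  mdiff phi (mdiff_from f y v) = mdiff_from (phi \o f) y v.
Proof.
move=> fs phis; apply: esym.
exact: (diff_smooth_map v fs phis (chart_at_atlas _) (chart_at_atlas _)
  (chart_at_dom _) (chart_at_dom _)).
Qed.

Lemma smooth_map_id : smooth_map idfun.
Proof.
split; first by move=> x; exact: cvg_id.
move=> c d x ac ad cx dx.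
have [tcd _] := atlas_compat ac ad.
apply: (smooth_on_differentiable tcd); split; first exact: chart_funS.
by rewrite chart_funK.
Qed.

(** Changing charts is the chain rule for the identity map of M. *)
Lemma mdiff_from_chart {V : normedModType R} (f : V -> M) (y : V) (v : V)
    (c : chart R n M) : smooth_at f y -> atlas c -> chart_dom c (f y) ->
  mdiff_from f y v =
    'd (chart_at (f y) \o chart_inv c) (c (f y)) ('d (c \o f) y v).
Proof.
move=> fs ac cfy.
exact: (diff_smooth_map v fs smooth_map_id ac (chart_at_atlas _) cfy
  (chart_at_dom _)).
Qed.

Lemma smooth_at_chart_inv (c : chart R n M) y :
  atlas c -> chart_cod c y -> smooth_at (chart_inv c) y.
Proof.
move=> ac cy; split; first exact: chart_inv_cont.
move=> d ad dy; have [tcd _] := atlas_compat ac ad.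
exact: (smooth_on_differentiable tcd (conj cy dy)).
Qed.

(** The chart parametrization at x, followed by psi, is a map from R^n to which
    the chain rule above applies. *)
Lemma mdiff_comp (phi psi : M -> M) (x : M) (v : tangent x) :
  smooth_map phi -> smooth_map psi ->
  mdiff (phi \o psi) v = mdiff phi (mdiff psi v).
Proof.
move=> phis psis.
have sc : smooth_at (chart_inv (chart_at x)) (chart_at x x).
  apply: smooth_at_chart_inv (chart_at_atlas x) _.
  exact: chart_funS (chart_at_dom x).
have xK := chart_funK (chart_at_dom x).
have := diff_smooth_map (c := chart_at (psi x)) (d := chart_at (phi (psi x))) v
  (smooth_at_comp sc psis) phis (chart_at_atlas _) (chart_at_atlas _).
rewrite /= xK => /(_ (chart_at_dom _) (chart_at_dom _)).
exact.
Qed.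

Lemma smooth_flow_map (L : R -> M -> M) t : smooth_flow L -> smooth_map (L t).
Proof.
move=> [Lc Ld]; split=> [x|c d x ac ad cx dx].
  apply: (@cvg_comp _ _ _ (fun x : M => (t, x)) (fun p => L p.1 p.2)
    _ (nbhs (t, x))); last exact: (Lc (t, x)).
  apply: (@cvg_pair M R M (nbhs x) (nbhs t) (nbhs x) _ _ _ (cst t) id).
    exact: cvg_cst.
  exact: cvg_id.
have Ldx : differentiable (fun p : R * 'rV[R]_n => d (L p.1 (chart_inv c p.2)))
    (t, c x).
  apply: (smooth_on_differentiable (Ld c d ac ad)).
  by split=> /=; [exact: chart_funS|rewrite chart_funK].
have dt : differentiable (fun y : 'rV[R]_n => (t, y)) (c x).
  by apply: (@differentiable_pair _ _ _ _ (cst t) id); exact: ex_diff.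
exact: (differentiable_comp dt Ldx).
Qed.

End ChartCalculus.

(** * The transverse quadratic form of a riemannian foliation *)

Section TransverseForm.
Local Open Scope ring_scope.
Context {R : realType} {M : smooth_manifold R 3}.
Variables (F : foliation M) (iota : M -> 'rV[R]_2 -> M) (eps : M -> R).
Hypothesis box_ok : forall x, [/\ transversal_disk F iota x, 0 < eps x &
       open_embedding (flow_box eps x) (iota_tilde F iota x)].
Variable h : 'rV[R]_2 -> 'rV[R]_2 -> 'rV[R]_2 -> R.
Hypothesis h_metric : riemannian_metric_on disk h.
Hypothesis h_inv : holonomy_invariant F iota eps h.

Local Notation V := ('rV[R]_2 * R)%type.
Local Notation it := (iota_tilde F iota).
Local Notation box := (flow_box eps).
Local Notation push x q := (mdiff_from (it x) q).

Lemma disk0 : @disk R 0.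
Proof. by rewrite /disk/= big1 ?ltr01// => i _; rewrite mxE expr0n. Qed.

Lemma flow_box0s x s : `|s| < eps x -> box x (0, s).
Proof. by move=> sx; split=> /=; [exact: disk0|rewrite -ltr_norml]. Qed.

Lemma flow_box0 x : box x 0.
Proof. by apply: flow_box0s; rewrite normr0; case: (box_ok x). Qed.

Lemma iota_tilde0 x : it x 0 = x.
Proof. by rewrite /it flow0; case: (box_ok x) => -[]. Qed.

Lemma flow_smooth_map t : smooth_map (flow F t).
Proof. exact/smooth_flow_map/flow_smooth. Qed.

Lemma iota_tilde_smooth x q : box x q -> smooth_at (it x) q.
Proof. by move=> bq; case: (box_ok x) => _ _ [[/smooth_into_at/(_ bq)]]. Qed.

Lemma iota_smooth x : smooth_at (iota x) 0.
Proof.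
by case: (box_ok x) => -[[/smooth_into_at/(_ disk0)]].
Qed.

Lemma push_bij x q : box x q ->
  exists B : {linear 'rV[R]_3 -> V},
    [/\ continuous B, cancel (push x q) B & cancel B (push x q)].
Proof.
move=> bq; case: (box_ok x) => _ _ [[_ /(_ q bq) inj _ _] _].
exact: (@linear_inj_inverse R 2 ('d (chart_at (it x q) \o it x) q)).
Qed.

(** In a flow box the flow is the translation of the time coordinate. *)
Lemma push_vf x q : box x q -> push x q (0, 1) = fol_vf F (it x q).
Proof.
move=> bq; have [_ /(_ _ (chart_at_atlas _) (chart_at_dom _)) dit] :=
  iota_tilde_smooth bq.
rewrite /mdiff_from -deriveE// -(flow_velocity F (iota x q.1) q.2).
rewrite /velocity /derive; apply: f_equal; apply: (f_equal (fun k => k @ _)).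
by apply/funext => r; rewrite /iota_tilde/= scaler0 add0r.
Qed.

Lemma disk_open : open (@disk R).
Proof.
rewrite (_ : disk = (fun y : 'rV[R]_2 => \sum_i y 0 i ^+ 2) @^-1` [set r | r < 1])//.
apply: open_comp; last exact: open_lt.
move=> y _; apply: (cvg_sum (F := nbhs y)) => i.
have -> : (fun x : 'rV[R]_2 => x 0 i ^+ 2) = (fun x => x 0 i * x 0 i).
  by apply/funext => x; rewrite expr2.
by apply: cvgM; exact: coord_continuous.
Qed.

Lemma flow_box_open x : open (box x).
Proof.
rewrite (_ : box x = (fst @^-1` disk) `&`
  (snd @^-1` [set r | - eps x < r] `&` snd @^-1` [set r | r < eps x])).
  apply: openI.
    by apply: open_comp; [move=> p _; exact: cvg_fst|exact: disk_open].
  apply: openI.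
    by apply: open_comp; [move=> p _; exact: cvg_snd|exact: open_gt].
  by apply: open_comp; [move=> p _; exact: cvg_snd|exact: open_lt].
apply/seteqP; split=> [p [? /andP[]]//|p [? [? ?]]]; split => //.
exact/andP.
Qed.

Lemma iota_tilde_open x (A : set V) : open A -> A `<=` box x ->
  open (it x @` A).
Proof.
move=> oA Ab; case: (box_ok x) => _ _ [[_ _ _ /(_ A oA Ab)[B oB ->]] ob].
exact: openI.
Qed.

(** [box_proj] is the first component of this inverse; the differentiability
    argument needs both components. *)
Definition box_inv x : M -> V := 'pinv_(fun=> 0) (box x) (it x).

Lemma box_pinvK x q : box x q -> box_inv x (it x q) = q.
Proof.
move=> bq; case: (box_ok x) => _ _ [[_ _ inj _] _].
by apply: pinvKV => //; exact: mem_set.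
Qed.

Lemma box_pinvKV x z : box_image F iota eps x z -> it x (box_inv x z) = z.
Proof. by move=> bz; apply: pinvK; exact: mem_set. Qed.

Lemma box_pinv_continuous x q : box x q -> {for it x q, continuous (box_inv x)}.
Proof.
move=> bq A; rewrite (box_pinvK bq) => Aq.
have : nbhs q (A `&` box x).
  by apply: filterI => //; exact: open_nbhs_nbhs (conj (@flow_box_open x) bq).
rewrite nbhsE => -[B [oB Bq] BA].
have BS : B `<=` box x by move=> p /BA[].
have : nbhs (it x q) (it x @` B).
  apply: open_nbhs_nbhs; split; first exact: iota_tilde_open.
  by exists q.
by apply: filterS => _ [p Bp <-]; rewrite /= box_pinvK//; [case: (BA p Bp)|exact: BS].
Qed.

Lemma diff_box_inv x q (B : {linear 'rV[R]_3 -> V}) :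
  box x q -> continuous B -> cancel (push x q) B ->
  is_diff (chart_at (it x q) (it x q))
    (box_inv x \o chart_inv (chart_at (it x q))) B.
Proof.
move=> bq cB BK; set z := it x q; set c := chart_at z.
have cz : chart_dom c z := chart_at_dom z.
have gz : (box_inv x \o chart_inv c) (c z) = q.
  by rewrite /= chart_funK// box_pinvK.
have [_ /(_ c (chart_at_atlas _) cz) dit] := iota_tilde_smooth bq.
have ccz := chart_inv_cont (chart_funS cz).
have cg : {for c z, continuous (box_inv x \o chart_inv c)}.
  apply: continuous_comp; first exact: ccz.
  by rewrite chart_funK//; exact: (box_pinv_continuous bq).
have bz : nbhs (chart_inv c (c z)) (box_image F iota eps x).
  rewrite chart_funK//; apply: open_nbhs_nbhs; split; last by exists q.
  by apply: iota_tilde_open => //; exact: flow_box_open.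
have nc : nbhs (c z) (chart_cod c).
  by apply: open_nbhs_nbhs; split; [exact: chart_cod_open|exact: chart_funS].
have fg : \forall y \near c z,
    (c \o it x) ((box_inv x \o chart_inv c) y) = y.
  apply: filterS2 nc (ccz _ bz) => y cy yb.
  by rewrite /= box_pinvKV// chart_invK.
apply: (@is_diff_right_inverse R V _ (c \o it x) (box_inv x \o chart_inv c)
  (c z) B cB _ _ cg fg); rewrite gz; first exact: dit.
exact: BK.
Qed.

(** The centre z of its own box is iota_z (0), so that transverse vectors are
    moved by the differential of iota_z itself, the map that enters the
    holonomy. *)
Lemma push_iota z xi tau :
  (push z 0 (xi, tau) : 'rV[R]_3) =
  'd (chart_at z \o iota z) 0 xi + tau *: (fol_vf F z : 'rV[R]_3).
Proof.
have [_ dit] := iota_tilde_smooth (flow_box0 z).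
have {}dit := dit (chart_at z) (chart_at_atlas z).
rewrite iota_tilde0 in dit; have {}dit := dit (chart_at_dom z).
have vfE : 'd (chart_at z \o it z) 0 (0, 1) = (fol_vf F z : 'rV[R]_3).
  by have := push_vf (flow_box0 z); rewrite /mdiff_from iota_tilde0.
have d0 : is_diff (0 : 'rV[R]_2) (fun a => (a, 0 : R)) (fun a => (a, 0 : R)).
  by apply: is_diff_eq.
have -> : chart_at z \o iota z = (chart_at z \o it z) \o (fun a => (a, 0)).
  by apply/funext => a; rewrite /= /iota_tilde/= flow0.
rewrite (diff_compE xi (ex_diff (is_diff_def := d0)) dit).
rewrite -vfE -linearZ -linearD /mdiff_from iota_tilde0.
rewrite -[in RHS]/((('d (fun a : 'rV[R]_2 => (a, 0 : R)) 0 : _ -> _) xi)).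
rewrite (diff_val (is_diff_def := d0)).
congr ('d _ _ _); apply/pair_equal_spec; split; rewrite /= ?scaler0 ?addr0//.
by rewrite add0r -[RHS]/(tau * 1) mulr1.
Qed.

(** This is where holonomy invariance enters.  The holonomy map from the disk
    centred at it x q to the disk centred at x sends 0 to q.1.  Its differential
    sends xi = eta'.1 to eta.1: by [push_iota], 'd iota_z xi differs from
    push x q eta by a multiple of the vector field, which by [push_vf] has no
    transverse part in the box at x. *)
Lemma holonomy_push x q eta eta' : box x q ->
  (push x q eta : 'rV[R]_3) = push (it x q) 0 eta' ->
  h q.1 eta.1 eta.1 = h 0 eta'.1 eta'.1.
Proof.
move=> bq; have [B [cB BK _]] := push_bij bq.
have db := diff_box_inv bq cB BK.
set z := it x q in db *; set c := chart_at z in db *.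
case: eta' => xi tau; rewrite push_iota -/c => eta_xi.
have iz : iota z 0 = z by case: (box_ok z) => -[].
have cz : chart_dom c z := chart_at_dom z.
have [ic dc] := iota_smooth z.
have {}dc : differentiable (c \o iota z) 0.
  by apply: dc; [exact: chart_at_atlas|rewrite iz].
have etaE : eta.1 = (B ('d (c \o iota z) 0 xi)).1.
  rewrite -[eta]BK eta_xi linearD linearZ /= -(push_vf bq) BK /=.
  by rewrite scaler0 addr0.
have dG : is_diff ((c \o iota z) 0) (box_inv x \o chart_inv c) B.
  by rewrite /= iz.
have {dG}[dG GE] := dG.
have [dfst fstE] := is_diff_fst ((box_inv x \o chart_inv c) ((c \o iota z) 0)).
have dfG := differentiable_comp dG dfst.
have near_hol : \forall a \near (0 : 'rV[R]_2),
    ((fst \o (box_inv x \o chart_inv c)) \o (c \o iota z)) a =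
    holonomy F iota eps x z a.
  have : \forall a \near (0 : 'rV[R]_2), chart_dom c (iota z a).
    by apply: near_chart_dom => //; rewrite iz.
  by apply: filterS => a ca /=; rewrite chart_funK.
have dhol u : 'd (holonomy F iota eps x z) 0 u = (B ('d (c \o iota z) 0 u)).1.
  apply: (etrans (near_eq_diff u near_hol (differentiable_comp dc dfG))).
  apply: (etrans (diff_compE u dc dfG)).
  apply: (etrans (diff_compE _ dG dfst)).
  by move: (congr1 (fun k => k ('d (c \o iota z) 0 u)) GE) => /= ->;
    exact: (congr1 (fun k => k _) fstE).
have hol0 : holonomy F iota eps x z 0 = q.1.
  by rewrite /holonomy/= iz -[box_proj _ _ _ _ _]/(box_inv x z).1 box_pinvK.
have dom0 : holonomy_dom F iota eps x z 0.
  by split; [exact: disk0|rewrite /= iz; exists q].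
by have := h_inv dom0 xi xi; rewrite hol0 !dhol -etaE.
Qed.

(** The box used at z is the one centred at z: the holonomy maps start from the
    disks iota_z, so these are the boxes that holonomy compares with any other
    box through z. *)
Definition transverse_sq (z : M) (v : 'rV[R]_3) : R :=
  let xi := (xget 0 [set eta | push z 0 eta = v :> 'rV[R]_3]).1 in h 0 xi xi.

Lemma push0_surj z (v : tangent z) :
  exists eta, push z 0 eta = v :> 'rV[R]_3.
Proof. by have [B [_ _ BK]] := push_bij (flow_box0 z); exists (B v). Qed.

(** This frees the form from the boxes of its definition: along a flow line, or
    near a given point, it can be computed in a single box. *)
Lemma transverse_sq_push x q eta : box x q ->
  transverse_sq (it x q) (push x q eta) = h q.1 eta.1 eta.1.
Proof.
move=> bq; have [eta' e] := push0_surj (push x q eta).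
set S := [set eta' | push (it x q) 0 eta' = push x q eta :> 'rV[R]_3].
have Sx : S (xget 0 S) by apply: xgetPex; exists eta'.
exact: (esym (holonomy_push bq (esym Sx))).
Qed.

(** Both points lie in the box centred at z, where the flow acts by translation
    of the time coordinate and leaves transverse parts unchanged. *)
Lemma transverse_sq_flow_small z s (v : tangent z) : `|s| < eps z ->
  transverse_sq (flow F s z) (mdiff (flow F s) v) = transverse_sq z v.
Proof.
move=> sz; have [eta <-] := push0_surj v.
have bs := flow_box0s sz.
have -> : transverse_sq z (push z 0 eta) = h 0 eta.1 eta.1.
  by have := transverse_sq_push eta (flow_box0 z); rewrite iota_tilde0.
rewrite -(transverse_sq_push eta bs).
have isE : it z (0, s) = flow F s z.
  by rewrite /iota_tilde/=; case: (box_ok z) => -[_ ->].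
have e1 := mdiff_mdiff_from eta (iota_tilde_smooth (flow_box0 z))
  (flow_smooth_map s).
have {}e1 w : w = it z 0 -> mdiff (flow F s) (push z 0 eta : tangent w) =
    mdiff_from (flow F s \o it z) 0 eta :> 'rV[R]_3.
  by move=> ->; exact: e1.
rewrite -isE; congr (transverse_sq _ _).
apply: (etrans (e1 z (esym (iota_tilde0 z)))).
have [_ dit] := iota_tilde_smooth bs.
have {}dit := dit _ (chart_at_atlas _) (chart_at_dom _).
apply: (etrans _ (diff_comp_shift eta dit)).
have fE : chart_at ((flow F s \o it z) 0) \o (flow F s \o it z) =
    (chart_at (it z (0, s)) \o it z) \o shift (0, s).
  rewrite isE /= iota_tilde0; apply/funext => p /=.
  by rewrite /iota_tilde/= -flowD addr0 addrC.
by rewrite /mdiff_from fE.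
Qed.

(** As a function of t the left-hand side is locally constant, by the previous
    lemma at each point of the orbit and functoriality of the differential;
    hence it has zero derivative everywhere. *)
Lemma transverse_sq_flow z t (v : tangent z) :
  transverse_sq (flow F t z) (mdiff (flow F t) v) = transverse_sq z v.
Proof.
pose f t := transverse_sq (flow F t z) (mdiff (flow F t) v).
have fD t' s : `|s| < eps (flow F t' z) -> f (s + t') = f t'.
  move=> st; rewrite /f -(transverse_sq_flow_small _ st).
  rewrite -(mdiff_comp v (flow_smooth_map s) (flow_smooth_map t')).
  rewrite flowD; congr (transverse_sq _ (mdiff _ v)).
  by apply/funext => y; rewrite flowD.
have f0 : f 0 = transverse_sq z v.
  by apply: transverse_sq_flow_small; rewrite normr0; case: (box_ok z).
rewrite -f0 -[LHS]/(f t); apply: is_derive_0_is_cst => r.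
have dcst := @is_derive_cst R R R (f r) r 1.
apply: (@near_eq_is_derive _ _ _ _ _ _ _ _ _ dcst).
have e0 : 0 < eps (flow F r z) by case: (box_ok (flow F r z)).
near=> r'; have r'r : `|r' - r| < eps (flow F r z).
  by rewrite distrC; near: r'; exact: (nbhsx_ballx r _ e0).
by rewrite -(fD _ _ r'r) subrK.
Unshelve. all: by end_near. Qed.

Lemma metric_sym_bilinear (g : riemannian_metric M) (z : M) :
  sym_bilinear (g z).
Proof. by have [bl bs _] := metric_inner g z. Qed.

(** In the fixed chart c, the vector pushed from q has coordinates depending
    continuously on q, and so have the coefficients of g; the sum S expresses
    the left-hand side through them. *)
Lemma metric_push_cvg (g : riemannian_metric M) (w : M) (eta eta' : V) :
  g (it w q) (push w q eta) (push w q eta') @[q --> (0 : V)] -->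
  g (it w 0) (push w 0 eta) (push w 0 eta').
Proof.
have b0 := flow_box0 w.
set c := chart_at (it w 0); have cw : chart_dom c (it w 0) := chart_at_dom _.
have ac : atlas c := chart_at_atlas _.
have [itc _] := iota_tilde_smooth b0.
pose D q v : 'rV[R]_3 := 'd (c \o it w) q v.
pose G y i j : R := g (chart_inv c y)
  (dchart_inv c y (delta_mx 0 i)) (dchart_inv c y (delta_mx 0 j)).
pose S q : R := \sum_(i < 3) \sum_(j < 3)
  D q eta 0 i * D q eta' 0 j * G (c (it w q)) i j.
have gS q : box w q -> chart_dom c (it w q) ->
    S q = g (it w q) (push w q eta) (push w q eta').
  move=> bq cq; pose y := c (it w q).
  have gb : sym_bilinear (fun u v : 'rV[R]_3 =>
      g (chart_inv c y) (dchart_inv c y u) (dchart_inv c y v)).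
    have [gl gs] := metric_sym_bilinear g (chart_inv c y).
    by split=> [a u v x|u v]; [rewrite /dchart_inv linearP gl|rewrite gs].
  have pE xi : dchart_inv c y (D q xi) = push w q xi :> 'rV[R]_3.
    rewrite /dchart_inv /y chart_funK//; apply: esym.
    exact: (mdiff_from_chart xi (iota_tilde_smooth bq)).
  rewrite -!pE -(chart_funK cq); apply: esym.
  exact: (sym_bilinear_sum _ _ gb).
have nearS : \forall q \near (0 : V),
    S q = g (it w q) (push w q eta) (push w q eta').
  have nb : nbhs (0 : V) (box w).
    by apply: open_nbhs_nbhs; split=> //; exact: flow_box_open.
  by apply: filterS2 nb (near_chart_dom itc cw) => q; exact: gS.
rewrite -(nbhs_singleton nearS).
apply: cvg_trans (near_eq_cvg nearS) _.
have citc : c (it w q) @[q --> (0 : V)] --> c (it w 0).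
  by apply: (cvg_comp _ _ itc); exact: chart_fun_cont.
have Dc xi i : D q xi 0 i @[q --> (0 : V)] --> D 0 xi 0 i.
  case: (box_ok w) => _ _ [[[_ /(_ c ac) sm] _ _ _] _].
  have := smooth_on_diff_continuous (v := xi) sm (conj b0 cw) => Dc.
  exact: (@cvg_comp _ _ _ (D^~ xi) (fun u : 'rV[R]_3 => u 0 i) _ _ _ Dc
    (@coord_continuous R 1 3 0 i (D 0 xi))).
apply: (cvg_sum (F := nbhs (0 : V))) => i.
apply: (cvg_sum (F := nbhs (0 : V))) => j.
apply: cvgM; first by apply: cvgM; exact: Dc.
have := smooth_on_continuous (metric_smooth g ac (delta_mx 0 i) (delta_mx 0 j))
  (chart_funS cw) => Gc.
exact: (cvg_comp _ _ citc Gc).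
Qed.

(** In the box centred at w both forms become families on one vector space: the
    transverse form is h at a varying point of the disk, and g is positive
    definite at w, so [near_form_le] compares them. *)
Lemma transverse_sq_le (g : riemannian_metric M) (w : M) :
  exists2 K, 0 < K & \forall z \near w, forall v : tangent z,
    transverse_sq z v <= K * g z v v.
Proof.
have b0 := flow_box0 w.
have [B0 [_ BK0 B0K]] := push_bij b0.
have nb : nbhs (0 : V) (box w).
  by apply: open_nbhs_nbhs; split=> //; exact: flow_box_open.
have [h_inner h_smooth] := h_metric.
have bq_bilin q : sym_bilinear (fun u v : 'rV[R]_3 =>
    g (it w q) (push w q (B0 u)) (push w q (B0 v))).
  have [gl gs] := metric_sym_bilinear g (it w q).
  by split=> [a u v x|u v]; [rewrite /mdiff_from !linearP gl|rewrite gs].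
have [] := @near_form_le R V (nbhs (0 : V)) _ 3
  (fun q u v => h q.1 (B0 u).1 (B0 v).1)
  (fun q u v => g (it w q) (push w q (B0 u)) (push w q (B0 v)))
  (fun u v => h 0 (B0 u).1 (B0 v).1)
  (fun u v => g (it w 0) (push w 0 (B0 u)) (push w 0 (B0 v))).
- apply: filterS nb => q [dq _]; have [hl hs _] := h_inner _ dq.
  by split=> [a u v x|u v]; [rewrite linearP hl|rewrite hs].
- exact: nearW.
- exact: bq_bilin.
- move=> u u0; have [_ _ gpos] := metric_inner g (it w 0).
  by apply: gpos; rewrite B0K.
- move=> u v; have hc := smooth_on_continuous (h_smooth (B0 u).1 (B0 v).1) disk0.
  have fst0 : (fst : V -> 'rV[R]_2) q @[q --> (0 : V)] --> (0 : 'rV[R]_2).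
    exact: cvg_fst.
  exact: (@cvg_comp _ _ _ fst (fun y => h y (B0 u).1 (B0 v).1) _ _ _ fst0 hc).
- by move=> u v; exact: metric_push_cvg.
move=> K K0 hK; exists K => //.
have : nbhs (0 : V) (box w `&` [set q | forall u, h q.1 (B0 u).1 (B0 u).1 <=
   K * g (it w q) (push w q (B0 u)) (push w q (B0 u))]) by exact: filterI.
rewrite nbhsE => -[A [oA A0] AS].
have Ab : A `<=` box w by move=> q /AS[].
have : nbhs w (it w @` A).
  apply: open_nbhs_nbhs; split; first exact: iota_tilde_open.
  by exists 0 => //; exact: iota_tilde0.
apply: filterS => _ [q Aq <-] v.
have [bq {}hK] := AS q Aq.
have [B [_ _ BK]] := push_bij bq.
have <- : push w q (B v) = v by exact: BK.
rewrite transverse_sq_push// -(BK0 (B v)).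
exact: hK.
Qed.

(** The metric of the disk is positive definite, so xi vanishes and only the
    multiple tau of the vector field remains. *)
Lemma transverse_sq_eq0 (z : M) (v : tangent z) :
  transverse_sq z v <= 0 -> v \in <[fol_vf F z]>%VS.
Proof.
have b0 := flow_box0 z; have [[xi tau] <-] := push0_surj v.
have -> : transverse_sq z (push z 0 (xi, tau)) = h 0 xi xi.
  by have := transverse_sq_push (xi, tau) b0; rewrite iota_tilde0.
have [h_inner _] := h_metric; have [_ _ hpos] := h_inner 0 disk0.
move=> h0; have xi0 : xi = 0.
  by apply/eqP; apply: contraTT h0 => /hpos; rewrite -ltNge.
rewrite push_iota xi0 linear0 add0r.
exact: (memvZ _ (memv_line (fol_vf F z))).
Qed.

Hypothesis M_compact : compact [set: M].

(** At a cluster point w of the orbit points, g dominates the form up to a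
    constant K, while g-lengths below r = sqrt (transverse_sq z v / K) occur
    near w: an invariant positive value would be smaller than itself. *)
Lemma contracted_transverse_sq (g : riemannian_metric M) (z : M)
    (v : tangent z) (t : nat -> R) :
  metric_norm g (mdiff (flow F (t k)) v) @[k --> \oo] --> (0 : R) ->
  transverse_sq z v <= 0.
Proof.
move=> gt0; rewrite leNgt; apply/negP => v0.
have [w [_ clw]] := M_compact (fmap_proper_filter (fun k => flow F (t k) z) _)
  (filterT : ((fun k => flow F (t k) z) @ \oo) setT).
have [K K0 hK] := transverse_sq_le g w.
pose r := Num.sqrt (transverse_sq z v / K).
have r0 : 0 < r by rewrite sqrtr_gt0 divr_gt0.
have small : \forall k \near \oo, metric_norm g (mdiff (flow F (t k)) v) < r.
  exact: (cvgr_lt _ gt0).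
have : ((fun k => flow F (t k) z) @ \oo)
  ((fun k => flow F (t k) z) @` [set k | metric_norm g (mdiff (flow F (t k)) v) < r]).
  by apply: filterS small => k kr; exists k.
move=> /clw /(_ hK)[_ [[k /= kr <-]]] /(_ (mdiff (flow F (t k)) v)).
rewrite transverse_sq_flow; apply/negP; rewrite -ltNge.
have [_ _ gpos] := metric_inner g (flow F (t k) z).
rewrite mulrC -ltr_pdivlMr//.
set u := mdiff (flow F (t k)) v in kr *.
have gu0 : 0 <= g (flow F (t k) z) u u.
  have [->|/gpos/ltW//] := eqVneq u 0.
  by rewrite (sym_bilinear0 _ (metric_sym_bilinear g _)).
rewrite -[X in X < _]sqr_sqrtr// -[X in _ < X]sqr_sqrtr; last first.
  by rewrite divr_ge0// ltW.
by rewrite ltr_pXn2r// ?nnegrE ?sqrtr_ge0.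
Qed.

(** The operator norm only controls vectors of length at most 1, hence the
    rescaling of v. *)
Lemma contracted_sub_line (g : riemannian_metric M) (z : M)
    (E : {vspace tangent z}) (C lam : R) (t : nat -> R) : 0 < lam < 1 ->
  (forall k, (opnorm_on g E (mdiff (flow F (t k)) (x := z))
                <= (C * lam ^+ k)%:E)%E) ->
  (E <= <[fol_vf F z]>)%VS.
Proof.
move=> /andP[lam0 lam1] tE; apply/subvP => v vE.
pose a := (1 + metric_norm g v)^-1.
have a0 : 0 < a by rewrite invr_gt0 ltr_pwDl// sqrtr_ge0.
have av1 : metric_norm g (a *: v) <= 1.
  rewrite /metric_norm (sym_bilinearZ _ _ (metric_sym_bilinear g z)).
  rewrite sqrtrM ?sqr_ge0// sqrtr_sqr gtr0_norm// /a mulrC.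
  by rewrite ler_pdivrMr ?mul1r ?ltr_pwDl ?sqrtr_ge0// lerDr.
suff av : a *: v \in <[fol_vf F z]>%VS.
  by rewrite -(scalerK (lt0r_neq0 a0) v) memvZ.
apply: transverse_sq_eq0; apply: (contracted_transverse_sq (g := g) (t := t)).
apply: (@squeeze_cvgr _ _ _ _ (cst 0) (fun k => C * lam ^+ k)).
- near=> k; rewrite sqrtr_ge0/= -lee_fin; apply: le_trans (tE k).
  apply: ereal_sup_ubound; exists (a *: v) => //; split=> //.
  exact: memvZ.
- exact: cvg_cst.
- by apply: cvg_geometric; rewrite gtr0_norm.
Unshelve. all: by end_near. Qed.

End TransverseForm.

(** * Absence of hyperbolicity *)

Theorem theorem1p3 (R : realType) (M : smooth_manifold R 3)
    (O : set (chart R 3 M)) (F : foliation M) :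
  [set: M] !=set0 ->
  compact [set: M] ->
  connected [set: M] ->
  orientation O ->
  riemannian_foliation F ->
  forall g : riemannian_metric M, ~ hyperbolic_set F g [set: M].
Proof.
move=> [x _] cM _ _ [iota [eps [box_ok [h [h_metric h_inv]]]]] g.
move=> [_ _ [C [lam [Ess [Euu [Ec [_ lam01 hyp]]]]]]].
(* The splitting at a single point suffices; times k and - k are used for the
   stable and the unstable direction. *)
have {hyp}[[sumE _] [XEc _ dimEc] _ Ess_le Euu_le] := hyp x Logic.I.
have X_sub : (<[fol_vf F x]> <= Ec x)%VS by rewrite -memvE.
have Ess_sub : (Ess x <= Ec x)%VS.
  apply: subv_trans X_sub.
  apply: (contracted_sub_line box_ok h_metric h_inv cM (g := g) (C := C)
    (t := fun k => k%:R%R) lam01) => k.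
  rewrite -powR_mulrn; first exact: Ess_le.
  by have /andP[/ltW] := lam01.
have Euu_sub : (Euu x <= Ec x)%VS.
  apply: subv_trans X_sub.
  apply: (contracted_sub_line box_ok h_metric h_inv cM (g := g) (C := C)
    (t := fun k => (- k%:R)%R) lam01) => k.
  rewrite -powR_mulrn; last by have /andP[/ltW] := lam01.
  have k0 : (- k%:R <= 0 :> R)%R by rewrite oppr_le0.
  by have := Euu_le _ k0; rewrite opprK.
have : \dim (Ec x) = 3.
  rewrite -(addv_idPr (_ : Ess x + Euu x <= Ec x)%VS) ?subv_add ?Ess_sub//.
  by rewrite sumE dimvf.
by rewrite dimEc.
Qed.
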